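(* Let $I\subset\mathbb{R}$ be an interval and let $\gamma(s)=\alpha(s)+\varepsilon\beta(s)$, $s\in I$, be an arc-length parametrized smooth curve in $\mathbb{D}_1^2$ with $\alpha''\neq0$ and $\beta'\neq0$ on $I$. Let $\kappa_\gamma$ and $\kappa_\alpha$ denote the curvatures of $\gamma$ and of its real part $\alpha$, respectively, and let $\theta(s)=\int^s\kappa_\alpha(u)\,du$ be an antiderivative of $\kappa_\alpha$. Then $\kappa_\gamma=\kappa_\alpha\neq0$ if and only if, up to isometries of $\mathbb{L}^2$, $\gamma$ admits one of the following parametrizations, for some $m\in\mathbb{R}$, $m>0$: (a) if $\gamma$ is spacelike, $$\gamma(s)=\left(\int^s\cosh\theta(u)\,du,\int^s\sinh\theta(u)\,du\right)+\varepsilon\, m\left(\int^s\sinh\theta(u)\,du,\int^s\cosh\theta(u)\,du\right);$$ (b) if $\gamma$ is timelike, $$\gamma(s)=\left(\int^s\sinh\theta(u)\,du,\int^s\cosh\theta(u)\,du\right)+\varepsilon\, m\left(\int^s\cosh\theta(u)\,du,\int^s\sinh\theta(u)\,du\right).$$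
   Context: $\mathbb{D}=\{x+\varepsilon y: x,y\in\mathbb{R}\}$, $\varepsilon^2=0$, $\varepsilon\neq0$, is the ring of dual numbers. $\mathbb{L}^2$ is $\mathbb{R}^2$ with the metric $\langle u,v\rangle=u_1v_1-u_2v_2$, and $\mathbb{D}_1^2$ is $\mathbb{D}^2$ with the $\mathbb{D}$-bilinear extension of $\langle\cdot,\cdot\rangle$. A smooth curve of a real variable is written $\gamma=\alpha+\varepsilon\beta$ with $\alpha,\beta:I\to\mathbb{L}^2$ smooth (real and dual parts). A vector $u\in\mathbb{L}^2$ is spacelike if $\langle u,u\rangle>0$ or $u=0$, and timelike if $\langle u,u\rangle<0$; $\gamma$ is spacelike (timelike) if $\alpha'(s)$ is a nonzero spacelike (timelike) vector for all $s$. $\gamma$ is arc-length parametrized if $|\gamma'|=1$, i.e. $\langle\alpha',\alpha'\rangle=\delta\in\{-1,1\}$ and $\langle\alpha',\beta'\rangle=0$ on $I$. For a dual number $a+\varepsilon b$ with $a\neq0$, $|a+\varepsilon b|=\mathrm{sign}(a)(a+\varepsilon b)$, and for $a>0$, $\sqrt{a+\varepsilon b}=\sqrt a+\varepsilon\frac{b}{2\sqrt a}$. The curvature of $\gamma$ (with $\alpha''\ne0$) is $\kappa_\gamma=\sqrt{|\langle\gamma'',\gamma''\rangle|}$, a $\mathbb{D}$-valued function, and that of $\alpha$ is $\kappa_\alpha=\sqrt{|\langle\alpha'',\alpha''\rangle|}$. An isometry of $\mathbb{L}^2$ is a map $p\mapsto Ap+b$ with $A^\top MA=M$, $M=\mathrm{diag}(1,-1)$,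 acting on curves by $\alpha+\varepsilon\beta\mapsto(A\alpha+b)+\varepsilon A\beta$. Indefinite integrals are determined up to additive constants.
   Formalization: The curve may be traversed in either direction (s = ±t, θ adapted), equivalently m ≠ 0 instead of m > 0; with m > 0 as written the claim fails for γ' = (cosh s, sinh s) − ε(sinh s, cosh s). *)

(* Defs.v *)
From Stdlib Require Import Reals ClassicalEpsilon.
From Coquelicot Require Import Coquelicot.

Open Scope R_scope.

(** * Calculus on an interval *)

(** Intervals may be open, closed, half-open or unbounded, but are not reduced
    to a point, since smoothness is meaningless there. *)
Definition is_interval (I : R -> Prop) : Prop :=
  (forall a b x, I a -> I b -> a <= x <= b -> I x) /\
  (exists a b, I a /\ I b /\ a < b).

(** [D_in f d I x] is the derivative within [I]: one-sided at an endpoint of [I]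
    that belongs to [I].  Values of [f] outside [I] play no role. *)
Definition deriv (I : R -> Prop) (f : R -> R) (x : R) : R :=
  epsilon (inhabits 0) (fun l => D_in f (fun _ => l) I x).

Definition derivn (I : R -> Prop) (n : nat) (f : R -> R) : R -> R :=
  Nat.iter n (deriv I) f.

Definition smooth_on (I : R -> Prop) (f : R -> R) : Prop :=
  forall n x, I x -> D_in (derivn I n f) (derivn I (S n) f) I x.

Definition antiderivative_on (I : R -> Prop) (f F : R -> R) : Prop :=
  forall x, I x -> D_in F f I x.

(** * The Lorentzian plane *)

Definition vec : Type := (R * R)%type.

Definition vzero : vec := (0, 0).
Definition vadd (u v : vec) : vec := (fst u + fst v, snd u + snd v).
Definition lor (u v : vec) : R := fst u * fst v - snd u * snd v.

Definition spacelike (u : vec) : Prop := lor u u > 0 \/ u = vzero.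
Definition timelike (u : vec) : Prop := lor u u < 0.

Definition vderiv (I : R -> Prop) (a : R -> vec) (s : R) : vec :=
  (deriv I (fun t => fst (a t)) s, deriv I (fun t => snd (a t)) s).

Definition vsmooth_on (I : R -> Prop) (a : R -> vec) : Prop :=
  smooth_on I (fun t => fst (a t)) /\ smooth_on I (fun t => snd (a t)).

Record mat2 : Type := Mat2 { m11 : R; m12 : R; m21 : R; m22 : R }.

Definition mtrans (A : mat2) : mat2 := Mat2 (m11 A) (m21 A) (m12 A) (m22 A).

Definition mmul (A B : mat2) : mat2 :=
  Mat2 (m11 A * m11 B + m12 A * m21 B) (m11 A * m12 B + m12 A * m22 B)
       (m21 A * m11 B + m22 A * m21 B) (m21 A * m12 B + m22 A * m22 B).

Definition mapply (A : mat2) (u : vec) : vec :=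
  (m11 A * fst u + m12 A * snd u, m21 A * fst u + m22 A * snd u).

Definition lorM : mat2 := Mat2 1 0 0 (-1).

Definition lorentz_matrix (A : mat2) : Prop :=
  mmul (mtrans A) (mmul lorM A) = lorM.

(** * Dual numbers and the plane over them *)

(** [Dual x y] is [x + eps y] with [eps^2 = 0]. *)
Record dual : Type := Dual { rpart : R; dpart : R }.

Definition dual_of_R (x : R) : dual := Dual x 0.
Definition dminus (z w : dual) : dual :=
  Dual (rpart z - rpart w) (dpart z - dpart w).
Definition dmult (z w : dual) : dual :=
  Dual (rpart z * rpart w) (rpart z * dpart w + dpart z * rpart w).

(** Meaningful for a nonzero real part. *)
Definition dabs (z : dual) : dual := dmult (dual_of_R (sign (rpart z))) z.

(** Meaningful for a positive real part. *)
Definition dsqrt (z : dual) : dual :=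
  Dual (sqrt (rpart z)) (dpart z / (2 * sqrt (rpart z))).

Definition dvec : Type := (dual * dual)%type.

Definition dlor (u v : dvec) : dual :=
  dminus (dmult (fst u) (fst v)) (dmult (snd u) (snd v)).

Definition mkdvec (u v : vec) : dvec :=
  (Dual (fst u) (fst v), Dual (snd u) (snd v)).
Definition vreal (u : dvec) : vec := (rpart (fst u), rpart (snd u)).
Definition vdual (u : dvec) : vec := (dpart (fst u), dpart (snd u)).

(** * Curves over the dual numbers, as functions of a real variable *)

Definition creal (g : R -> dvec) (s : R) : vec := vreal (g s).
Definition cdual (g : R -> dvec) (s : R) : vec := vdual (g s).

Definition csmooth_on (I : R -> Prop) (g : R -> dvec) : Prop :=
  vsmooth_on I (creal g) /\ vsmooth_on I (cdual g).

Definition cderiv (I : R -> Prop) (g : R -> dvec) (s : R) : dvec :=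
  mkdvec (vderiv I (creal g) s) (vderiv I (cdual g) s).

Definition spacelike_curve (I : R -> Prop) (g : R -> dvec) : Prop :=
  forall s, I s -> vderiv I (creal g) s <> vzero /\
                   spacelike (vderiv I (creal g) s).

Definition timelike_curve (I : R -> Prop) (g : R -> dvec) : Prop :=
  forall s, I s -> vderiv I (creal g) s <> vzero /\
                   timelike (vderiv I (creal g) s).

Definition arc_length_param (I : R -> Prop) (g : R -> dvec) : Prop :=
  exists delta : R, (delta = -1 \/ delta = 1) /\
    forall s, I s ->
      lor (vderiv I (creal g) s) (vderiv I (creal g) s) = delta /\
      lor (vderiv I (creal g) s) (vderiv I (cdual g) s) = 0.

Definition curvature (I : R -> Prop) (a : R -> vec) (s : R) : R :=
  sqrt (Rabs (lor (vderiv I (vderiv I a) s) (vderiv I (vderiv I a) s))).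

Definition dcurvature (I : R -> Prop) (g : R -> dvec) (s : R) : dual :=
  dsqrt (dabs (dlor (cderiv I (cderiv I g) s) (cderiv I (cderiv I g) s))).

(** The action of the isometry [p |-> A p + b] on curves. *)
Definition isom_act (A : mat2) (b : vec) (g : R -> dvec) (s : R) : dvec :=
  mkdvec (vadd (mapply A (creal g s)) b) (mapply A (cdual g s)).

(** * The two normal forms

    Each occurrence of an indefinite integral is an arbitrary antiderivative,
    with its own additive constant. *)

Definition spacelike_form (I : R -> Prop) (theta : R -> R) (m : R)
    (g : R -> dvec) : Prop :=
  exists C0 S0 C1 S1 : R -> R,
    antiderivative_on I (fun u => cosh (theta u)) C0 /\
    antiderivative_on I (fun u => sinh (theta u)) S0 /\
    antiderivative_on I (fun u => cosh (theta u)) C1 /\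
    antiderivative_on I (fun u => sinh (theta u)) S1 /\
    forall s, I s -> g s = mkdvec (C0 s, S0 s) (m * S1 s, m * C1 s).

Definition timelike_form (I : R -> Prop) (theta : R -> R) (m : R)
    (g : R -> dvec) : Prop :=
  exists C0 S0 C1 S1 : R -> R,
    antiderivative_on I (fun u => cosh (theta u)) C0 /\
    antiderivative_on I (fun u => sinh (theta u)) S0 /\
    antiderivative_on I (fun u => cosh (theta u)) C1 /\
    antiderivative_on I (fun u => sinh (theta u)) S1 /\
    forall s, I s -> g s = mkdvec (S0 s, C0 s) (m * C1 s, m * S1 s).

(** A curve admits a parametrization of the given form up to isometries when
    this holds for the curve traversed in one of its two directions, i.e. after
    an arc-length parameter change [s = e t] with [e = 1] or [e = -1].  If [k]
    is the curvature in [s] and [theta' = k], then [t |-> e * theta (e * t)] is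
    an antiderivative of the curvature [t |-> k (e * t)] in [t].

    Both directions are needed because [m > 0].  In either form the dual part
    has velocity [m / k] times the acceleration of the real part.  This factor
    is invariant under isometries and changes sign with the direction. *)
Definition admits_up_to_isometry
    (form : (R -> Prop) -> (R -> R) -> R -> (R -> dvec) -> Prop)
    (I : R -> Prop) (theta : R -> R) (g : R -> dvec) : Prop :=
  exists e : R, (e = 1 \/ e = -1) /\
  exists (A : mat2) (b : vec), lorentz_matrix A /\
  exists m : R, 0 < m /\
    form (fun t => I (e * t)) (fun t => e * theta (e * t)) m
         (isom_act A b (fun t => g (e * t))).

(* Main.v *)
Require Import Defs.
From Stdlib Require Import Reals.
From Coquelicot Require Import Coquelicot.
From Stdlib Require Import Lra.
Open Scope R_scope.

(** Write [a], [b] for the velocities of the real and dual parts, [c] and [d]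
    for their derivatives, and [delta = <a,a>].  In a Lorentzian plane the
    vectors orthogonal to [a] are the multiples of the swapped vector
    [(a2, a1)], so both [b] and [c] are such multiples, with coefficients
    [delta * det a b] and [delta * det a c] ([orthogonal_to_unit]).  Hence the
    curvature of the real part is [|det a c|], which vanishes nowhere, and the
    dual part of the curvature vanishes exactly when [<c,d>] does
    ([dcurvature_real_iff]).  Since [<c,d> = - delta * det a c * (det a b)']
    ([lor_accelerations]), the curvature condition says precisely that [det a b]
    is constant on the interval.

    If [gamma] has a normal form, [det a b] is constant because an isometry
    multiplies it by its determinant and in the normal forms it equals
    [m] or [-m], by [cosh^2 - sinh^2 = 1] ([det_velocities_constant]).

    Conversely let [b = lambda (a2, a1)] with [lambda] constant.  The function
    [det a c] has a constant sign ([constant_sign]), so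
    [theta' = sigma * delta * det a c] with a constant sign [sigma].  The
    system [a1' = sigma theta' a2], [a2' = sigma theta' a1] is linear with
    hyperbolic solutions
    [a = (p cosh theta + sigma q sinh theta, q cosh theta + sigma p sinh theta)]
    and [p^2 - q^2 = delta] ([velocity_hyperbolic_angle]).  The Lorentz matrix
    built from [p] and [q] carries [a] to [(cosh theta, sigma sinh theta)] or
    [(sigma sinh theta, cosh theta)]; reflections in the axes then absorb
    [sigma] and a change of direction [e].  The factor of the dual part becomes
    [e sigma lambda], and [e] is chosen to make it positive
    ([admits_spacelike_form], [admits_timelike_form]). *)

(** * Derivatives within an interval *)

(** The derivative of [f] at the single point [x], as a number: for a point by
    point computation this is handier than a derivative function.  It is convertible to [D_in f d I x] when
    [l] is [d x]. *)
Definition D_at (I : R -> Prop) (f : R -> R) (l x : R) : Prop :=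
  D_in f (fun _ => l) I x.

Lemma D_at_eq I f l l' x : D_at I f l x -> l = l' -> D_at I f l' x.
Proof. now intros H <-. Qed.

Lemma D_at_ext I f g l x :
  (forall y, I y -> f y = g y) -> I x -> D_at I f l x -> D_at I g l x.
Proof.
  intros E Ix H eps He.
  destruct (H eps He) as [alp [Ha K]].
  exists alp; split; [exact Ha|].
  intros y [[Iy ne] Hd].
  rewrite <- (E y Iy), <- (E x Ix).
  now apply K.
Qed.

Lemma D_at_subset (I J : R -> Prop) f l x :
  (forall y, J y -> I y) -> D_at I f l x -> D_at J f l x.
Proof.
  intros S H eps He.
  destruct (H eps He) as [alp [Ha K]].
  exists alp; split; [exact Ha|].
  intros y [[Jy ne] Hd].
  apply K; repeat split; auto.
Qed.

(** A nondegenerate interval accumulates at each of its points, endpoints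
    included. *)
Lemma D_at_unique I f l l' x :
  is_interval I -> I x -> D_at I f l x -> D_at I f l' x -> l = l'.
Proof.
  intros [conv [a [b [Ia [Ib ab]]]]] Ix H H'.
  refine (single_limit _ _ _ _ x _ H H').
  intros alp Ha.
  (* One of [a], [b] differs from [x]; move from [x] towards it. *)
  destruct (Rlt_or_le x b) as [xb|bx].
  - exists (x + Rmin (alp / 2) (b - x)).
    assert (0 < Rmin (alp / 2) (b - x)) by (apply Rmin_glb_lt; lra).
    pose proof (Rmin_l (alp / 2) (b - x)).
    pose proof (Rmin_r (alp / 2) (b - x)).
    repeat split; [apply (conv x b); auto; lra | lra |].
    unfold Rdist; rewrite Rabs_right; lra.
  - exists (x - Rmin (alp / 2) (x - a)).
    assert (0 < Rmin (alp / 2) (x - a)) by (apply Rmin_glb_lt; lra).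
    pose proof (Rmin_l (alp / 2) (x - a)).
    pose proof (Rmin_r (alp / 2) (x - a)).
    repeat split; [apply (conv a x); auto; lra | lra |].
    unfold Rdist; rewrite Rabs_left; lra.
Qed.

Lemma D_at_const I k x : D_at I (fun _ => k) 0 x.
Proof. exact (Dconst I k x). Qed.

Lemma D_at_plus I f g l m x :
  D_at I f l x -> D_at I g m x -> D_at I (fun t => f t + g t) (l + m) x.
Proof. exact (Dadd I (fun _ => l) (fun _ => m) f g x). Qed.

Lemma D_at_minus I f g l m x :
  D_at I f l x -> D_at I g m x -> D_at I (fun t => f t - g t) (l - m) x.
Proof. exact (Dminus I (fun _ => l) (fun _ => m) f g x). Qed.

Lemma D_at_mult I f g l m x :
  D_at I f l x -> D_at I g m x ->
  D_at I (fun t => f t * g t) (l * g x + f x * m) x.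
Proof. exact (Dmult I (fun _ => l) (fun _ => m) f g x). Qed.

Lemma D_at_scal I f l k x :
  D_at I f l x -> D_at I (fun t => k * f t) (k * l) x.
Proof. exact (Dmult_const I f (fun _ => l) x k). Qed.

Lemma D_at_comp I f g l m x :
  D_at I f l x -> derivable_pt_lim g (f x) m ->
  D_at I (fun t => g (f t)) (m * l) x.
Proof.
  intros Hf Hg.
  apply (derivable_pt_lim_D_in g (fun _ => m)) in Hg.
  apply (D_at_subset (Dgf I no_cond f)).
  - now intros y Iy; split.
  - apply (D_at_eq _ _ (l * m)); [exact (Dcomp _ _ _ _ _ _ _ Hf Hg) | ring].
Qed.

(** Pulling back along [t |-> e * t] also pulls back the domain; it serves the
    two directions of travel [e = 1] and [e = -1]. *)
Lemma D_at_reparam I f l e x :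
  D_at I f l (e * x) ->
  D_at (fun t => I (e * t)) (fun t => f (e * t)) (e * l) x.
Proof.
  intros H.
  pose proof (D_at_scal no_cond _ _ e x (Dx no_cond x)) as He.
  apply (D_at_subset (Dgf no_cond I (fun t => e * t))).
  - now intros y Iy; split.
  - apply (D_at_eq _ _ (e * 1 * l)); [exact (Dcomp _ _ _ _ _ _ _ He H) | ring].
Qed.

(** * From pointwise derivatives to global statements *)

(** The retraction of the line onto [[a, b]].  At an endpoint of [I] only
    one-sided information is available; precomposing with [clamp] gives
    functions on the whole line, to which the usual intermediate and mean value
    theorems apply. *)
Definition clamp (a b x : R) : R := Rmax a (Rmin x b).

Lemma clamp_range a b x : a <= b -> a <= clamp a b x <= b.
Proof.
  intros ab; unfold clamp, Rmax, Rmin.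
  destruct (Rle_dec x b); destruct (Rle_dec a _); lra.
Qed.

Lemma clamp_id a b x : a <= x <= b -> clamp a b x = x.
Proof.
  intros ab; unfold clamp, Rmax, Rmin.
  destruct (Rle_dec x b); destruct (Rle_dec a _); lra.
Qed.

Lemma clamp_lipschitz a b x y :
  Rabs (clamp a b x - clamp a b y) <= Rabs (x - y).
Proof.
  unfold clamp, Rmax, Rmin, Rabs.
  repeat destruct (Rle_dec _ _); repeat destruct (Rcase_abs _); lra.
Qed.

Lemma continuity_clamp I f a b :
  (forall x, a <= x <= b -> I x) ->
  (forall x, I x -> continue_in f I x) ->
  a <= b -> continuity (fun x => f (clamp a b x)).
Proof.
  intros sub cont ab x eps He.
  destruct (cont _ (sub _ (clamp_range a b x ab)) eps He) as [alp [Ha K]].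
  exists alp; split; [exact Ha|].
  intros y [_ Hd]; simpl in *.
  destruct (Req_dec (clamp a b y) (clamp a b x)) as [E|ne].
  - rewrite E; unfold Rdist; rewrite Rminus_diag, Rabs_R0; exact He.
  - apply K; repeat split; auto.
    + exact (sub _ (clamp_range a b y ab)).
    + eapply Rle_lt_trans; [apply clamp_lipschitz | exact Hd].
Qed.

Lemma interval_between I a b :
  is_interval I -> I a -> I b -> forall x, Rmin a b <= x <= Rmax a b -> I x.
Proof.
  intros [conv _] Ia Ib x; unfold Rmin, Rmax.
  destruct (Rle_dec a b); intros Hx.
  - now apply (conv a b).
  - now apply (conv b a).
Qed.

Lemma constant_of_D_at_zero I f :
  is_interval I -> (forall x, I x -> D_at I f 0 x) ->
  forall a b, I a -> I b -> f a = f b.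
Proof.
  intros HI Df a b Ia Ib.
  pose proof (Rmin_Rmax a b) as mM.
  pose proof (interval_between I a b HI Ia Ib) as sub.
  set (F := fun x => f (clamp (Rmin a b) (Rmax a b) x)).
  assert (Fid : forall x, Rmin a b <= x <= Rmax a b -> F x = f x)
    by (intros x Hx; unfold F; now rewrite clamp_id).
  destruct (MVT_gen F a b (fun _ => 0)) as [c [_ E]].
  - intros x Hx.
    (* A ball around an interior point stays in the subinterval, where the
       retraction is the identity. *)
    apply is_derive_Reals.
    intros eps He.
    destruct (Df x (sub x ltac:(lra)) eps He) as [alp [Ha K]].
    assert (0 < Rmin alp (Rmin (x - Rmin a b) (Rmax a b - x))) as Hpos
      by (repeat apply Rmin_glb_lt; lra).
    exists (mkposreal _ Hpos); simpl.
    intros h hne Hh.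
    pose proof (Rmin_l alp (Rmin (x - Rmin a b) (Rmax a b - x))).
    pose proof (Rmin_r alp (Rmin (x - Rmin a b) (Rmax a b - x))).
    pose proof (Rmin_l (x - Rmin a b) (Rmax a b - x)).
    pose proof (Rmin_r (x - Rmin a b) (Rmax a b - x)).
    assert (- Rabs h <= h <= Rabs h)
      by (split; [pose proof (Rabs_maj2 h); lra | apply Rle_abs]).
    rewrite !Fid by lra.
    specialize (K (x + h)); simpl in K; unfold Rdist in K.
    replace (x + h - x) with h in K by ring.
    apply K; repeat split; [apply sub; lra | lra | lra].
  - intros x _.
    apply continuity_clamp with (I := I); auto.
    intros y Iy; exact (cont_deriv f (fun _ => 0) I y (Df y Iy)).
  - rewrite !Fid in E; [lra | |]; split;
      auto using Rmin_l, Rmin_r, Rmax_l, Rmax_r.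
Qed.

Lemma constant_sign I f :
  is_interval I -> (forall x, I x -> continue_in f I x) ->
  (forall x, I x -> f x <> 0) ->
  exists sigma, (sigma = 1 \/ sigma = -1) /\
    forall x, I x -> Rabs (f x) = sigma * f x.
Proof.
  intros HI cont nz.
  assert (same : forall a b, I a -> I b -> 0 < f a -> f b < 0 -> False).
  { intros a b Ia Ib pa nb.
    pose proof (interval_between I a b HI Ia Ib) as sub.
    destruct (IVT_gen (fun x => f (clamp (Rmin a b) (Rmax a b) x)) a b 0)
      as [x [Hx E]].
    - apply continuity_clamp with (I := I); auto using Rmin_Rmax.
    - rewrite !clamp_id
        by (split; auto using Rmin_l, Rmin_r, Rmax_l, Rmax_r).
      rewrite Rmin_right, Rmax_left; lra.
    - rewrite clamp_id in E by exact Hx.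
      exact (nz x (sub x Hx) E). }
  destruct HI as [_ [a [_ [Ia _]]]].
  destruct (Rdichotomy _ _ (nz a Ia)) as [na|pa].
  - exists (-1); split; [now right|]; intros x Ix.
    destruct (Rdichotomy _ _ (nz x Ix)).
    + rewrite Rabs_left; lra.
    + now destruct (same x a).
  - exists 1; split; [now left|]; intros x Ix.
    destruct (Rdichotomy _ _ (nz x Ix)).
    + now destruct (same a x).
    + rewrite Rabs_right; lra.
Qed.

(** * Vector-valued functions *)

Definition vD_at (I : R -> Prop) (u : R -> vec) (v : vec) (x : R) : Prop :=
  D_at I (fun t => fst (u t)) (fst v) x /\
  D_at I (fun t => snd (u t)) (snd v) x.

Definition vscal (k : R) (u : vec) : vec := (k * fst u, k * snd u).

(** The area form, which up to sign is [lor] of the swap of [u] with [v]; along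
    a unit [u] it reads off the coordinate of a vector orthogonal to [u]. *)
Definition det (u v : vec) : R := fst u * snd v - snd u * fst v.

Definition mdet (A : mat2) : R := m11 A * m22 A - m12 A * m21 A.

Lemma vD_at_unique I u v w x :
  is_interval I -> I x -> vD_at I u v x -> vD_at I u w x -> v = w.
Proof.
  intros HI Ix [H1 H2] [K1 K2].
  apply injective_projections; eapply D_at_unique; eauto.
Qed.

(** The curvature involves the first two derivatives; the third one serves the
    continuity of the second, from which [det a c] gets a constant sign. *)
Lemma vsmooth_vD_at I u x :
  vsmooth_on I u -> I x ->
  vD_at I u (vderiv I u x) x /\
  vD_at I (vderiv I u) (vderiv I (vderiv I u) x) x /\
  vD_at I (vderiv I (vderiv I u)) (vderiv I (vderiv I (vderiv I u)) x) x.
Proof.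
  intros [S1 S2] Ix; repeat split.
  - exact (S1 0%nat x Ix).
  - exact (S2 0%nat x Ix).
  - exact (S1 1%nat x Ix).
  - exact (S2 1%nat x Ix).
  - exact (S1 2%nat x Ix).
  - exact (S2 2%nat x Ix).
Qed.

Lemma D_at_lor I u v u' v' x :
  vD_at I u u' x -> vD_at I v v' x ->
  D_at I (fun t => lor (u t) (v t)) (lor u' (v x) + lor (u x) v') x.
Proof.
  intros [U1 U2] [V1 V2].
  eapply D_at_eq.
  - exact (D_at_minus _ _ _ _ _ _ (D_at_mult _ _ _ _ _ _ U1 V1)
             (D_at_mult _ _ _ _ _ _ U2 V2)).
  - unfold lor; ring.
Qed.

Lemma D_at_det I u v u' v' x :
  vD_at I u u' x -> vD_at I v v' x ->
  D_at I (fun t => det (u t) (v t)) (det u' (v x) + det (u x) v') x.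
Proof.
  intros [U1 U2] [V1 V2].
  eapply D_at_eq.
  - exact (D_at_minus _ _ _ _ _ _ (D_at_mult _ _ _ _ _ _ U1 V2)
             (D_at_mult _ _ _ _ _ _ U2 V1)).
  - unfold det; ring.
Qed.

Lemma lor_const_derivative I u v u' v' k x :
  is_interval I -> (forall t, I t -> lor (u t) (v t) = k) -> I x ->
  vD_at I u u' x -> vD_at I v v' x -> lor u' (v x) + lor (u x) v' = 0.
Proof.
  intros HI E Ix Hu Hv.
  refine (D_at_unique I _ _ _ x HI Ix (D_at_lor I u v u' v' x Hu Hv) _).
  apply (D_at_ext I (fun _ => k)); auto using D_at_const.
  intros y Iy; symmetry; auto.
Qed.

Lemma isom_act_vD_at I g A b e u w x :
  vD_at I (creal g) u (e * x) -> vD_at I (cdual g) w (e * x) ->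
  let h := isom_act A b (fun t => g (e * t)) in
  vD_at (fun t => I (e * t)) (creal h) (mapply A (vscal e u)) x /\
  vD_at (fun t => I (e * t)) (cdual h) (mapply A (vscal e w)) x.
Proof.
  intros [U1 U2] [W1 W2] h.
  apply D_at_reparam in U1, U2, W1, W2.
  repeat split; simpl.
  - eapply D_at_eq; [apply D_at_plus;
      [apply D_at_plus; apply D_at_scal; eassumption | apply D_at_const]|].
    simpl; ring.
  - eapply D_at_eq; [apply D_at_plus;
      [apply D_at_plus; apply D_at_scal; eassumption | apply D_at_const]|].
    simpl; ring.
  - apply D_at_plus; apply D_at_scal; assumption.
  - apply D_at_plus; apply D_at_scal; assumption.
Qed.

Lemma is_interval_reparam I e :
  e = 1 \/ e = -1 -> is_interval I -> is_interval (fun t => I (e * t)).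
Proof.
  intros He [conv [a [b [Ia [Ib ab]]]]]; split.
  - intros x y z Hx Hy Hz.
    destruct He as [-> | ->]; [apply (conv _ _ _ Hx Hy) | apply (conv _ _ _ Hy Hx)];
      lra.
  - destruct He as [-> | ->].
    + exists a, b; rewrite !Rmult_1_l; auto.
    + exists (- b), (- a).
      replace (-1 * - b) with b by ring; replace (-1 * - a) with a by ring.
      repeat split; auto; lra.
Qed.

Lemma det_mapply A u v : det (mapply A u) (mapply A v) = mdet A * det u v.
Proof. unfold det, mdet, mapply; simpl; ring. Qed.

(** [det] is multiplicative and [det M = -1]. In coordinates this is the
    Lagrange identity for the columns of [A], which are Lorentz orthonormal. *)
Lemma lorentz_matrix_mdet A : lorentz_matrix A -> mdet A * mdet A = 1.
Proof.
  destruct A as [a b c d]; unfold lorentz_matrix, mdet, lorM, mmul; simpl.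
  intros E; injection E; intros E22 E21 E12 E11.
  replace ((a * d - b * c) * (a * d - b * c)) with
    ((a * b - c * d) ^ 2 - (a * a - c * c) * (b * b - d * d)) by ring.
  replace (a * b - c * d) with 0 by lra.
  replace (a * a - c * c) with 1 by lra.
  replace (b * b - d * d) with (-1) by lra.
  ring.
Qed.

(** * Frames along a unit-speed curve *)

(** The orthogonal of a non-null vector is a line, and the swap of [a] lies on
    it: [a1 a2 - a2 a1 = 0].  The coefficient is found by applying [det a]. *)
Lemma orthogonal_to_unit a b delta :
  delta * delta = 1 -> lor a a = delta -> lor a b = 0 ->
  b = vscal (delta * det a b) (snd a, fst a).
Proof.
  destruct a as [a1 a2], b as [b1 b2]; unfold lor, det, vscal; simpl.
  intros D Ea Eb.
  f_equal.
  - replace (delta * (a1 * b2 - a2 * b1) * a2) with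
      (delta * ((a1 * a1 - a2 * a2) * b1 - a1 * (a1 * b1 - a2 * b2))) by ring.
    rewrite Ea, Eb, Rmult_0_r, Rminus_0_r, <- Rmult_assoc, D; ring.
  - replace (delta * (a1 * b2 - a2 * b1) * a1) with
      (delta * ((a1 * a1 - a2 * a2) * b2 - a2 * (a1 * b1 - a2 * b2))) by ring.
    rewrite Ea, Eb, Rmult_0_r, Rminus_0_r, <- Rmult_assoc, D; ring.
Qed.

Lemma det_orthogonal_neq0 a b delta :
  delta * delta = 1 -> lor a a = delta -> lor a b = 0 -> b <> vzero ->
  det a b <> 0.
Proof.
  intros D Ea Eb nz Z; apply nz.
  rewrite (orthogonal_to_unit a b delta D Ea Eb), Z.
  unfold vscal, vzero; f_equal; ring.
Qed.

Lemma lor_orthogonal a b c delta :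
  delta * delta = 1 -> lor a a = delta -> lor a b = 0 ->
  lor b c = - delta * det a b * det a c.
Proof.
  intros D Ea Eb.
  rewrite (orthogonal_to_unit a b delta D Ea Eb) at 1.
  unfold lor, vscal, det; simpl; ring.
Qed.

Lemma sqrt_lor_orthogonal a b delta :
  delta * delta = 1 -> lor a a = delta -> lor a b = 0 ->
  sqrt (Rabs (lor b b)) = Rabs (det a b).
Proof.
  intros D Ea Eb.
  rewrite (lor_orthogonal a b b delta D Ea Eb), Rmult_assoc, Rabs_mult.
  replace (Rabs (- delta)) with 1.
  - rewrite Rmult_1_l, Rabs_mult; apply sqrt_square, Rabs_pos.
  - assert (H : (delta - 1) * (delta + 1) = 0) by lra.
    apply Rmult_integral in H; destruct H as [H|H].
    + replace delta with 1 by lra; rewrite Rabs_left; lra.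
    + replace delta with (-1) by lra; rewrite Rabs_right; lra.
Qed.

(** For functions [a], [b] with derivatives [c], [d], the last factor is the
    derivative of [det a b]; there [det c b = 0] because [b]
    and [c] are both multiples of the swap of [a]. *)
Lemma lor_accelerations a b c d delta :
  delta * delta = 1 -> lor a a = delta -> lor a b = 0 -> lor a c = 0 ->
  lor c d = - delta * det a c * (det c b + det a d).
Proof.
  intros D Ea Eb Ec.
  rewrite (lor_orthogonal a c d delta D Ea Ec).
  replace (det c b) with 0; [ring|].
  rewrite (orthogonal_to_unit a b delta D Ea Eb),
    (orthogonal_to_unit a c delta D Ea Ec).
  unfold det, vscal; simpl; ring.
Qed.

Lemma sign_mult_self x : sign x * x = Rabs x.
Proof.
  destruct (Rtotal_order x 0) as [H|[->|H]].
  - rewrite sign_eq_m1, Rabs_left; lra.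
  - rewrite Rabs_R0; ring.
  - rewrite sign_eq_1, Rabs_right; lra.
Qed.

(** The dual part of [dsqrt (dabs z)] is a nonzero multiple of that of [z]. *)
Lemma dsqrt_dabs_real z x :
  rpart z <> 0 ->
  (dsqrt (dabs z) = dual_of_R x <-> sqrt (Rabs (rpart z)) = x /\ dpart z = 0).
Proof.
  intros nz.
  assert (R : rpart (dabs z) = Rabs (rpart z)) by apply sign_mult_self.
  assert (S : sign (rpart z) <> 0).
  { intros E; apply nz, Rabs_eq_0.
    now rewrite <- sign_mult_self, E, Rmult_0_l. }
  assert (P : sqrt (Rabs (rpart z)) <> 0).
  { intros E; apply (Rlt_not_eq _ _ (sqrt_lt_R0 _ (Rabs_pos_lt _ nz))); auto. }
  assert (Q : dpart (dabs z) = sign (rpart z) * dpart z)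
    by (unfold dabs, dmult, dual_of_R; simpl; ring).
  unfold dsqrt, dual_of_R; rewrite R, Q; split.
  - intros E; injection E as E1 E2; split; [exact E1|].
    apply (Rmult_eq_reg_l (sign (rpart z))); [|exact S].
    apply (Rmult_eq_reg_r (/ (2 * sqrt (Rabs (rpart z))))).
    + unfold Rdiv in E2; rewrite E2; ring.
    + apply Rinv_neq_0_compat; lra.
  - intros [E1 E2]; rewrite E1, E2; f_equal; unfold Rdiv; ring.
Qed.

(** [<gamma'',gamma''>] has real part [<c,c>] and dual part [2 <c,d>]; the real
    part alone already gives the curvature of the real curve. *)
Lemma dcurvature_real_iff I g s :
  let c := vderiv I (vderiv I (creal g)) s in
  let d := vderiv I (vderiv I (cdual g)) s in
  lor c c <> 0 ->
  (dcurvature I g s = dual_of_R (curvature I (creal g) s) <-> lor c d = 0).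
Proof.
  intros c d nz.
  set (z := dlor (mkdvec c d) (mkdvec c d)).
  assert (Ez : rpart z = lor c c) by reflexivity.
  assert (Dz : dpart z = 2 * lor c d)
    by (unfold z, dlor, dminus, dmult, lor; simpl; ring).
  change (dcurvature I g s) with (dsqrt (dabs z)).
  rewrite dsqrt_dabs_real, Ez, Dz by now rewrite Ez.
  change (curvature I (creal g) s) with (sqrt (Rabs (lor c c))).
  split; [intros [_ H]; lra | intros H; split; [reflexivity | lra]].
Qed.

Lemma cosh_sqr x : cosh x * cosh x = 1 + sinh x * sinh x.
Proof.
  pose proof (exp_plus x (- x)) as E.
  rewrite Rplus_opp_r, exp_0 in E; unfold cosh, sinh; lra.
Qed.

(** The flow of [a' = sigma theta' (a2, a1)] is the boost of angle
    [sigma theta]; undoing it on [a] gives a vector [(p, q)] with zero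
    derivative. Keeping [p] and [q] as parameters avoids defining the initial
    angle of [a] and distinguishing the branch of the hyperbola. *)
Lemma velocity_hyperbolic_angle I a c theta sigma delta :
  is_interval I -> sigma * sigma = 1 -> delta * delta = 1 ->
  (forall s, I s -> vD_at I a (c s) s) ->
  (forall s, I s -> lor (a s) (a s) = delta) ->
  (forall s, I s -> lor (a s) (c s) = 0) ->
  (forall s, I s -> D_at I theta (sigma * (delta * det (a s) (c s))) s) ->
  exists p q, p * p - q * q = delta /\ forall s, I s ->
    a s = (p * cosh (theta s) + sigma * q * sinh (theta s),
           q * cosh (theta s) + sigma * p * sinh (theta s)).
Proof.
  intros HI Hs Hd Da Ea Ec Dt.
  set (p := fun s => fst (a s) * cosh (theta s)
                     - sigma * (snd (a s) * sinh (theta s))).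
  set (q := fun s => snd (a s) * cosh (theta s)
                     - sigma * (fst (a s) * sinh (theta s))).
  assert (Dpq : forall s, I s -> D_at I p 0 s /\ D_at I q 0 s).
  { intros s Is.
    destruct (Da s Is) as [D1 D2].
    pose proof (D_at_comp I theta cosh _ _ s (Dt s Is)
                  (derivable_pt_lim_cosh _)) as Dch.
    pose proof (D_at_comp I theta sinh _ _ s (Dt s Is)
                  (derivable_pt_lim_sinh _)) as Dsh.
    rewrite (orthogonal_to_unit _ _ delta Hd (Ea s Is) (Ec s Is)) in D1, D2.
    simpl in D1, D2.
    set (mu := delta * det (a s) (c s)) in *.
    split; (eapply D_at_eq;
      [apply D_at_minus; [|apply D_at_scal]; apply D_at_mult; eassumption|]).
    - transitivity (mu * (1 - sigma * sigma) * snd (a s) * cosh (theta s));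
        [simpl; ring | rewrite Hs; ring].
    - transitivity (mu * (1 - sigma * sigma) * fst (a s) * cosh (theta s));
        [simpl; ring | rewrite Hs; ring]. }
  pose proof HI as [_ [s0 [_ [I0 _]]]].
  assert (Cp : forall s, I s -> p s = p s0)
    by (intros; eapply constant_of_D_at_zero; eauto; apply Dpq).
  assert (Cq : forall s, I s -> q s = q s0)
    by (intros; eapply constant_of_D_at_zero; eauto; apply Dpq).
  exists (p s0), (q s0); split.
  - transitivity (lor (a s0) (a s0) * (cosh (theta s0) * cosh (theta s0)
      - sigma * sigma * (sinh (theta s0) * sinh (theta s0))));
      [unfold p, q, lor; ring | rewrite cosh_sqr, Hs, (Ea s0 I0); ring].
  - intros s Is; rewrite <- (Cp s Is), <- (Cq s Is).
    apply injective_projections; unfold p, q; simpl.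
    + transitivity (fst (a s) * (cosh (theta s) * cosh (theta s)
        - sigma * sigma * (sinh (theta s) * sinh (theta s))));
        [rewrite cosh_sqr, Hs; ring | ring].
    + transitivity (snd (a s) * (cosh (theta s) * cosh (theta s)
        - sigma * sigma * (sinh (theta s) * sinh (theta s))));
        [rewrite cosh_sqr, Hs; ring | ring].
Qed.

(** * Normal forms *)

(** Since every antiderivative has its own additive constant, membership in a
    normal form is a condition on velocities alone.  The antiderivatives are
    recovered from the curve itself, the dual ones after division by [m]. *)
Lemma spacelike_form_velocity I theta m g :
  m <> 0 ->
  (spacelike_form I theta m g <-> forall s, I s ->
     vD_at I (creal g) (cosh (theta s), sinh (theta s)) s /\
     vD_at I (cdual g) (m * sinh (theta s), m * cosh (theta s)) s).
Proof.
  intros nz; split.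
  - intros (C0 & S0 & C1 & S1 & HC0 & HS0 & HC1 & HS1 & E) s Is.
    pose proof (D_at_scal I S1 _ m s (HS1 s Is)) as HS.
    pose proof (D_at_scal I C1 _ m s (HC1 s Is)) as HC.
    repeat split; (eapply D_at_ext; [|exact Is|]);
      [ | exact (HC0 s Is) | | exact (HS0 s Is) | | exact HS | | exact HC ];
      intros y Iy; unfold creal, cdual; now rewrite (E y Iy).
  - intros V.
    exists (fun s => fst (creal g s)), (fun s => snd (creal g s)),
      (fun s => / m * snd (cdual g s)), (fun s => / m * fst (cdual g s)).
    repeat split; intros s Is.
    + exact (proj1 (proj1 (V s Is))).
    + exact (proj2 (proj1 (V s Is))).
    + refine (D_at_eq _ _ _ _ _ (D_at_scal _ _ _ _ _ (proj2 (proj2 (V s Is)))) _).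
      simpl; now field.
    + refine (D_at_eq _ _ _ _ _ (D_at_scal _ _ _ _ _ (proj1 (proj2 (V s Is)))) _).
      simpl; now field.
    + rewrite <- !Rmult_assoc, Rinv_r, !Rmult_1_l by exact nz.
      unfold creal, cdual; now destruct (g s) as [[x x'] [y y']].
Qed.

Lemma timelike_form_velocity I theta m g :
  m <> 0 ->
  (timelike_form I theta m g <-> forall s, I s ->
     vD_at I (creal g) (sinh (theta s), cosh (theta s)) s /\
     vD_at I (cdual g) (m * cosh (theta s), m * sinh (theta s)) s).
Proof.
  intros nz; split.
  - intros (C0 & S0 & C1 & S1 & HC0 & HS0 & HC1 & HS1 & E) s Is.
    pose proof (D_at_scal I S1 _ m s (HS1 s Is)) as HS.
    pose proof (D_at_scal I C1 _ m s (HC1 s Is)) as HC.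
    repeat split; (eapply D_at_ext; [|exact Is|]);
      [ | exact (HS0 s Is) | | exact (HC0 s Is) | | exact HC | | exact HS ];
      intros y Iy; unfold creal, cdual; now rewrite (E y Iy).
  - intros V.
    exists (fun s => snd (creal g s)), (fun s => fst (creal g s)),
      (fun s => / m * fst (cdual g s)), (fun s => / m * snd (cdual g s)).
    repeat split; intros s Is.
    + exact (proj2 (proj1 (V s Is))).
    + exact (proj1 (proj1 (V s Is))).
    + refine (D_at_eq _ _ _ _ _ (D_at_scal _ _ _ _ _ (proj1 (proj2 (V s Is)))) _).
      simpl; now field.
    + refine (D_at_eq _ _ _ _ _ (D_at_scal _ _ _ _ _ (proj2 (proj2 (V s Is)))) _).
      simpl; now field.
    + rewrite <- !Rmult_assoc, Rinv_r, !Rmult_1_l by exact nz.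
      unfold creal, cdual; now destruct (g s) as [[x x'] [y y']].
Qed.

Lemma spacelike_form_det I theta m g s v w :
  is_interval I -> m <> 0 -> spacelike_form I theta m g -> I s ->
  vD_at I (creal g) v s -> vD_at I (cdual g) w s -> det v w = m.
Proof.
  intros HI nz F Is Hv Hw.
  destruct (proj1 (spacelike_form_velocity _ _ _ _ nz) F s Is) as [Hv' Hw'].
  rewrite (vD_at_unique _ _ _ _ _ HI Is Hv Hv'),
    (vD_at_unique _ _ _ _ _ HI Is Hw Hw').
  unfold det; simpl.
  transitivity (m * (cosh (theta s) * cosh (theta s) - sinh (theta s) * sinh (theta s)));
    [ring | rewrite cosh_sqr; ring].
Qed.

Lemma timelike_form_det I theta m g s v w :
  is_interval I -> m <> 0 -> timelike_form I theta m g -> I s ->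
  vD_at I (creal g) v s -> vD_at I (cdual g) w s -> det v w = - m.
Proof.
  intros HI nz F Is Hv Hw.
  destruct (proj1 (timelike_form_velocity _ _ _ _ nz) F s Is) as [Hv' Hw'].
  rewrite (vD_at_unique _ _ _ _ _ HI Is Hv Hv'),
    (vD_at_unique _ _ _ _ _ HI Is Hw Hw').
  unfold det; simpl.
  transitivity (- m * (cosh (theta s) * cosh (theta s) - sinh (theta s) * sinh (theta s)));
    [ring | rewrite cosh_sqr; ring].
Qed.

(** A Lorentz matrix scales [det] by its determinant [1] or [-1], and reversing
    the direction multiplies both velocities by [-1], so [det] is unaffected.
    The sign [k] distinguishes the two normal forms. *)
Lemma det_velocities_constant form k I theta g a b :
  is_interval I ->
  (forall J th m h t v w, is_interval J -> m <> 0 -> form J th m h -> J t ->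
     vD_at J (creal h) v t -> vD_at J (cdual h) w t -> det v w = k * m) ->
  (forall s, I s -> vD_at I (creal g) (a s) s) ->
  (forall s, I s -> vD_at I (cdual g) (b s) s) ->
  admits_up_to_isometry form I theta g ->
  exists r, forall s, I s -> det (a s) (b s) = r.
Proof.
  intros HI Hform Ha Hb (e & He & A & v & HA & m & Hm & F).
  exists (mdet A * (k * m)); intros s Is.
  assert (ee : e * e = 1) by (destruct He as [-> | ->]; ring).
  assert (es : e * (e * s) = s) by (rewrite <- Rmult_assoc, ee; ring).
  destruct (isom_act_vD_at I g A v e (a s) (b s) (e * s)) as [V W];
    [rewrite es; auto | rewrite es; auto |].
  assert (E := Hform _ _ _ _ (e * s) _ _ (is_interval_reparam I e He HI)
                 (Rgt_not_eq _ _ Hm) F ltac:(cbv beta; now rewrite es) V W).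
  rewrite det_mapply in E.
  rewrite <- E, <- Rmult_assoc, (lorentz_matrix_mdet A HA).
  transitivity (e * e * det (a s) (b s));
    [rewrite ee; ring | unfold det, vscal; simpl; ring].
Qed.

Lemma sinh_sign e x : e = 1 \/ e = -1 -> sinh (e * x) = e * sinh x.
Proof.
  intros [-> | ->].
  - now rewrite !Rmult_1_l.
  - replace (-1 * x) with (- x) by ring; unfold sinh.
    rewrite Ropp_involutive; field.
Qed.

Lemma cosh_sign e x : e = 1 \/ e = -1 -> cosh (e * x) = cosh x.
Proof.
  intros [-> | ->].
  - now rewrite !Rmult_1_l.
  - replace (-1 * x) with (- x) by ring; unfold cosh.
    rewrite Ropp_involutive; field.
Qed.

Lemma sign_choice x :
  x <> 0 -> exists e, (e = 1 \/ e = -1) /\ 0 < e * x.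
Proof.
  intros nz; destruct (Rdichotomy _ _ nz).
  - exists (-1); split; [now right | lra].
  - exists 1; split; [now left | lra].
Qed.

(** The isometry is the inverse boost of matrix [(p, -q; -q, p)], which undoes
    the constant part of [a], followed by the reflections [diag(e, sigma)].
    For the latter, reversal turns [(cosh, sigma sinh)] into
    [e (cosh, sigma sinh)], while the form wants [(cosh, e sinh)], the velocity
    of angle [e theta].  On the dual part these reflections leave the factor
    [e sigma lambda], and the choice of [e] makes it positive. *)
Lemma admits_spacelike_form I theta g a b p q sigma lambda :
  sigma = 1 \/ sigma = -1 -> lambda <> 0 -> p * p - q * q = 1 ->
  (forall s, I s -> vD_at I (creal g) (a s) s) ->
  (forall s, I s -> vD_at I (cdual g) (b s) s) ->
  (forall s, I s -> a s = (p * cosh (theta s) + sigma * q * sinh (theta s),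
                           q * cosh (theta s) + sigma * p * sinh (theta s))) ->
  (forall s, I s -> b s = vscal lambda (snd (a s), fst (a s))) ->
  admits_up_to_isometry spacelike_form I theta g.
Proof.
  intros Hs nz pq Ha Hb Ea Eb.
  assert (ss : sigma * sigma = 1) by (destruct Hs as [-> | ->]; ring).
  destruct (sign_choice (sigma * lambda)) as [e [He m0]];
    [apply Rmult_integral_contrapositive; lra|].
  assert (ee : e * e = 1) by (destruct He as [-> | ->]; ring).
  exists e; split; [exact He|].
  exists (Mat2 (e * p) (- (e * q)) (- (sigma * q)) (sigma * p)), vzero; split.
  { unfold lorentz_matrix, mmul, mtrans, lorM; simpl; f_equal.
    - transitivity (e * e * (p * p) - sigma * sigma * (q * q)); [ring|].
      rewrite ee, ss; lra.
    - transitivity ((sigma * sigma - e * e) * (p * q)); [ring|].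
      rewrite ee, ss; ring.
    - transitivity ((sigma * sigma - e * e) * (p * q)); [ring|].
      rewrite ee, ss; ring.
    - transitivity (e * e * (q * q) - sigma * sigma * (p * p)); [ring|].
      rewrite ee, ss; lra. }
  exists (e * (sigma * lambda)); split; [exact m0|].
  apply spacelike_form_velocity; [lra|].
  intros t It.
  destruct (isom_act_vD_at I g (Mat2 (e * p) (- (e * q)) (- (sigma * q)) (sigma * p))
    vzero e _ _ t (Ha _ It) (Hb _ It)) as [V W].
  rewrite (Eb _ It) in W; rewrite (Ea _ It) in V, W.
  rewrite (sinh_sign e), (cosh_sign e) by exact He.
  set (ch := cosh (theta (e * t))) in *; set (sh := sinh (theta (e * t))) in *.
  match type of V with vD_at _ _ ?v _ => replace v with (ch, e * sh) in V end.
  match type of W with vD_at _ _ ?v _ =>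
    replace v with (e * (sigma * lambda) * (e * sh), e * (sigma * lambda) * ch) in W end.
  - split; assumption.
  - unfold mapply, vscal; simpl; f_equal.
    + transitivity (e * e * (p * p - q * q) * (sigma * lambda * sh)); [|ring].
      rewrite pq; ring.
    + transitivity (e * (sigma * lambda) * (p * p - q * q) * ch); [|ring].
      rewrite pq; ring.
  - unfold mapply, vscal; simpl; f_equal.
    + transitivity (e * e * (p * p - q * q) * ch); [|ring].
      rewrite ee, pq; ring.
    + transitivity (sigma * sigma * (p * p - q * q) * (e * sh)); [|ring].
      rewrite ss, pq; ring.
Qed.

(** Now [p^2 - q^2 = -1], so the boost is [(q, -p; -p, q)]; it maps [a] to
    [(sigma sinh theta, cosh theta)], so the reflections become
    [diag(sigma, e)]. *)
Lemma admits_timelike_form I theta g a b p q sigma lambda :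
  sigma = 1 \/ sigma = -1 -> lambda <> 0 -> p * p - q * q = -1 ->
  (forall s, I s -> vD_at I (creal g) (a s) s) ->
  (forall s, I s -> vD_at I (cdual g) (b s) s) ->
  (forall s, I s -> a s = (p * cosh (theta s) + sigma * q * sinh (theta s),
                           q * cosh (theta s) + sigma * p * sinh (theta s))) ->
  (forall s, I s -> b s = vscal lambda (snd (a s), fst (a s))) ->
  admits_up_to_isometry timelike_form I theta g.
Proof.
  intros Hs nz pq Ha Hb Ea Eb.
  assert (ss : sigma * sigma = 1) by (destruct Hs as [-> | ->]; ring).
  destruct (sign_choice (sigma * lambda)) as [e [He m0]];
    [apply Rmult_integral_contrapositive; lra|].
  assert (ee : e * e = 1) by (destruct He as [-> | ->]; ring).
  exists e; split; [exact He|].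
  exists (Mat2 (sigma * q) (- (sigma * p)) (- (e * p)) (e * q)), vzero; split.
  { unfold lorentz_matrix, mmul, mtrans, lorM; simpl; f_equal.
    - transitivity (sigma * sigma * (q * q) - e * e * (p * p)); [ring|].
      rewrite ee, ss; lra.
    - transitivity ((e * e - sigma * sigma) * (p * q)); [ring|].
      rewrite ee, ss; ring.
    - transitivity ((e * e - sigma * sigma) * (p * q)); [ring|].
      rewrite ee, ss; ring.
    - transitivity (sigma * sigma * (p * p) - e * e * (q * q)); [ring|].
      rewrite ee, ss; lra. }
  exists (e * (sigma * lambda)); split; [exact m0|].
  apply timelike_form_velocity; [lra|].
  intros t It.
  destruct (isom_act_vD_at I g (Mat2 (sigma * q) (- (sigma * p)) (- (e * p)) (e * q))
    vzero e _ _ t (Ha _ It) (Hb _ It)) as [V W].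
  rewrite (Eb _ It) in W; rewrite (Ea _ It) in V, W.
  rewrite (sinh_sign e), (cosh_sign e) by exact He.
  set (ch := cosh (theta (e * t))) in *; set (sh := sinh (theta (e * t))) in *.
  match type of V with vD_at _ _ ?v _ => replace v with (e * sh, ch) in V end.
  match type of W with vD_at _ _ ?v _ =>
    replace v with (e * (sigma * lambda) * ch, e * (sigma * lambda) * (e * sh)) in W end.
  - split; assumption.
  - unfold mapply, vscal; simpl; f_equal.
    + transitivity (e * (sigma * lambda) * - (p * p - q * q) * ch); [|ring].
      rewrite pq; ring.
    + transitivity (e * e * - (p * p - q * q) * (sigma * lambda * sh)); [|ring].
      rewrite pq; ring.
  - unfold mapply, vscal; simpl; f_equal.
    + transitivity (sigma * sigma * - (p * p - q * q) * (e * sh)); [|ring].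
      rewrite ss, pq; ring.
    + transitivity (e * e * - (p * p - q * q) * ch); [|ring].
      rewrite ee, pq; ring.
Qed.

Theorem corollary4p7 :
  forall (I : R -> Prop) (gamma : R -> dvec) (theta : R -> R),
    is_interval I ->
    csmooth_on I gamma ->
    arc_length_param I gamma ->
    (forall s, I s -> vderiv I (vderiv I (creal gamma)) s <> vzero) ->
    (forall s, I s -> vderiv I (cdual gamma) s <> vzero) ->
    antiderivative_on I (curvature I (creal gamma)) theta ->
    ((forall s, I s ->
        dcurvature I gamma s = dual_of_R (curvature I (creal gamma) s) /\
        curvature I (creal gamma) s <> 0)
     <->
     ((spacelike_curve I gamma /\
         admits_up_to_isometry spacelike_form I theta gamma) \/
      (timelike_curve I gamma /\
         admits_up_to_isometry timelike_form I theta gamma))).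
Proof.
  intros I gamma theta HI [Sa Sb] (delta & Hdelta & Hal) Hacc Hvel Htheta.
  assert (dd : delta * delta = 1) by (destruct Hdelta as [-> | ->]; ring).
  set (a := vderiv I (creal gamma)) in *.
  set (b := vderiv I (cdual gamma)) in *.
  set (c := vderiv I a) in *.
  set (d := vderiv I b) in *.
  assert (Va : forall s, I s -> vD_at I (creal gamma) (a s) s)
    by (intros s Is; apply (vsmooth_vD_at I _ s Sa Is)).
  assert (Vb : forall s, I s -> vD_at I (cdual gamma) (b s) s)
    by (intros s Is; apply (vsmooth_vD_at I _ s Sb Is)).
  assert (Vc : forall s, I s -> vD_at I a (c s) s)
    by (intros s Is; apply (vsmooth_vD_at I _ s Sa Is)).
  assert (Vd : forall s, I s -> vD_at I b (d s) s)
    by (intros s Is; apply (vsmooth_vD_at I _ s Sb Is)).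
  assert (Eaa : forall s, I s -> lor (a s) (a s) = delta)
    by (intros s Is; apply (Hal s Is)).
  assert (Eab : forall s, I s -> lor (a s) (b s) = 0)
    by (intros s Is; apply (Hal s Is)).
  assert (Eac : forall s, I s -> lor (a s) (c s) = 0).
  { intros s Is.
    pose proof (lor_const_derivative I a a _ _ delta s HI Eaa Is
                  (Vc s Is) (Vc s Is)) as E.
    assert (lor (c s) (a s) = lor (a s) (c s)) by (unfold lor; ring).
    lra. }
  assert (mu0 : forall s, I s -> det (a s) (c s) <> 0)
    by (intros s Is; apply (det_orthogonal_neq0 _ _ delta); auto; now apply Hacc).
  assert (Ecurv : forall s, I s ->
            curvature I (creal gamma) s = Rabs (det (a s) (c s)))
    by (intros s Is; apply (sqrt_lor_orthogonal _ _ delta); auto).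
  assert (cc0 : forall s, I s -> lor (c s) (c s) <> 0).
  { intros s Is Z.
    apply (mu0 s Is), Rabs_eq_0.
    rewrite <- (Ecurv s Is).
    change (sqrt (Rabs (lor (c s) (c s))) = 0).
    now rewrite Z, Rabs_R0, sqrt_0. }
  (* The right-hand side is the vanishing of the derivative of [det a b]. *)
  assert (Hcurv : (forall s, I s ->
      dcurvature I gamma s = dual_of_R (curvature I (creal gamma) s) /\
      curvature I (creal gamma) s <> 0) <->
      (forall s, I s -> det (c s) (b s) + det (a s) (d s) = 0)).
  { split; intros H s Is.
    - destruct (H s Is) as [E _].
      apply (dcurvature_real_iff I gamma s (cc0 s Is)) in E.
      fold a b in E; fold c d in E.
      rewrite (lor_accelerations (a s) (b s) _ _ delta) in E by auto.
      apply Rmult_integral in E; destruct E as [E|E]; [exfalso|exact E].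
      apply Rmult_integral in E; destruct E as [E|E]; [|now apply (mu0 s)].
      destruct Hdelta; lra.
    - split.
      + apply (dcurvature_real_iff I gamma s (cc0 s Is)).
        fold a b; fold c d.
        rewrite (lor_accelerations (a s) (b s) _ _ delta) by auto.
        rewrite (H s Is); ring.
      + rewrite (Ecurv s Is); apply Rabs_no_R0; auto. }
  rewrite Hcurv; split.
  - intros H.
    assert (Hlam : exists lambda, lambda <> 0 /\
              forall s, I s -> b s = vscal lambda (snd (a s), fst (a s))).
    { pose proof HI as [_ [s0 [_ [I0 _]]]].
      exists (delta * det (a s0) (b s0)); split.
      - apply Rmult_integral_contrapositive; split; [destruct Hdelta; lra|].
        apply (det_orthogonal_neq0 _ _ delta); auto; now apply Hvel.
      - intros s Is.
        rewrite (constant_of_D_at_zero I (fun t => det (a t) (b t)) HI)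
          with (a := s0) (b := s); auto.
        + apply orthogonal_to_unit; auto.
        + intros x Ix; rewrite <- (H x Ix); apply D_at_det; auto. }
    destruct Hlam as [lambda [lam0 Eb]].
    destruct (constant_sign I (fun s => delta * det (a s) (c s)) HI)
      as [sigma [Hsigma Esigma]].
    { intros s Is.
      destruct (vsmooth_vD_at I _ s Sa Is) as [_ [Ka Kc]].
      refine (cont_deriv _ _ _ _ (D_at_scal _ _ _ delta _ (D_at_det _ _ _ _ _ _ Ka Kc))). }
    { intros s Is; apply Rmult_integral_contrapositive; split; auto.
      destruct Hdelta; lra. }
    assert (ss : sigma * sigma = 1) by (destruct Hsigma as [-> | ->]; ring).
    destruct (velocity_hyperbolic_angle I a c theta sigma delta)
      as (p & q & pq & Ea); auto.
    { intros s Is.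
      refine (D_at_eq _ _ _ _ _ (Htheta s Is) _).
      rewrite (Ecurv s Is), <- (Esigma s Is), Rabs_mult.
      replace (Rabs delta) with 1; [ring|].
      destruct Hdelta as [-> | ->]; [rewrite Rabs_left | rewrite Rabs_R1]; lra. }
    assert (a0 : forall s, I s -> a s <> vzero).
    { intros s Is Z; specialize (Eaa s Is); rewrite Z in Eaa.
      unfold lor, vzero in Eaa; simpl in Eaa; destruct Hdelta; lra. }
    destruct Hdelta as [-> | ->]; [right | left]; split.
    + intros s Is; split; [now apply a0|].
      unfold timelike; fold a; rewrite (Eaa s Is); lra.
    + eapply admits_timelike_form; eauto.
    + intros s Is; split; [now apply a0|].
      left; fold a; rewrite (Eaa s Is); lra.
    + eapply admits_spacelike_form; eauto.
  - intros F.
    assert (Hr : exists r, forall s, I s -> det (a s) (b s) = r).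
    { destruct F as [[_ F]|[_ F]].
      - apply (det_velocities_constant spacelike_form 1 I theta gamma a b);
          auto.
        intros J th m h t v w HJ nz Hf Jt Hv Hw.
        rewrite Rmult_1_l; eapply spacelike_form_det; eauto.
      - apply (det_velocities_constant timelike_form (-1) I theta gamma a b);
          auto.
        intros J th m h t v w HJ nz Hf Jt Hv Hw.
        replace (-1 * m) with (- m) by ring; eapply timelike_form_det; eauto. }
    destruct Hr as [r Hr]; intros s Is.
    refine (D_at_unique I _ _ _ s HI Is
              (D_at_det I a b _ _ s (Vc s Is) (Vd s Is)) _).
    apply (D_at_ext I (fun _ => r)); auto using D_at_const.
    intros y Iy; symmetry; auto.
Qed.
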